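(* Let $n \ge 1$ and let $F:\mathbb{R}^n\to\mathbb{R}^n$ be a $C^1$ map with Jacobian matrix $F'(x)$ at $x\in\mathbb{R}^n$. Suppose there exists $\varepsilon>0$ such that: (1) for every $x\in\mathbb{R}^n$, every (complex) eigenvalue $\lambda$ of $F'(x)$ satisfies $|\lambda|\ge\varepsilon$; and (2) either, for every $x\in\mathbb{R}^n$, every eigenvalue $\mu$ of the real symmetric matrix $F'(x)+F'(x)^T$ satisfies $\mu\ge\varepsilon$; or, for every $x\in\mathbb{R}^n$, every eigenvalue $\mu$ of $F'(x)+F'(x)^T$ satisfies $\mu\le-\varepsilon$. Then $F$ is injective. Moreover, $F$ has a $C^1$ inverse map, i.e. there exists a $C^1$ map $G:\mathbb{R}^n\to\mathbb{R}^n$ such that $F(G(x))=x$ and $G(F(x))=x$ for all $x\in\mathbb{R}^n$.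
   Context: $F'(x)$ denotes the $n\times n$ real Jacobian matrix of $F$ at $x$, and $A^T$ denotes the transpose of a matrix $A$. The eigenvalues of $F'(x)$ are its complex eigenvalues, and $|\lambda|$ is the complex modulus. Since $F'(x)+F'(x)^T$ is real symmetric, its eigenvalues are real. *)

(* Defs.v *)
From HB Require Import structures.
From mathcomp Require Import all_boot all_order all_algebra.
From mathcomp Require Import all_classical all_reals all_analysis.
From mathcomp Require Import complex.

Set Implicit Arguments.
Unset Strict Implicit.
Unset Printing Implicit Defensive.

Import Order.TTheory GRing.Theory Num.Theory.
Import numFieldNormedType.Exports.

Local Open Scope ring_scope.

(* R^n is rendered as 'rV[R]_n, and [jacobian F x] acts on row vectors from the
   right, so it is the transpose of the usual Jacobian matrix of F at x. *)
Definition jacobian_matrix (R : realType) (n : nat) (F : 'rV[R]_n -> 'rV[R]_n)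
  (x : 'rV[R]_n) : 'M[R]_n := (jacobian F x)^T.

Lemma jacobian_matrixE (R : realType) (n : nat) (F : 'rV[R]_n -> 'rV[R]_n)
    (x : 'rV[R]_n) (i j : 'I_n) : differentiable F x ->
  jacobian_matrix F x i j = 'D_(delta_mx 0 j) (fun y => F y 0 i) x.
Proof.
move=> dF; rewrite /jacobian_matrix mxE /jacobian.
have -> : lin1_mx ('d F x) j i = ((delta_mx 0 j : 'rV[R]_n) *m lin1_mx ('d F x)) 0 i.
  by rewrite -rowE [RHS]mxE.
rewrite mul_rV_lin1 -deriveE // derive_mx ?mxE //; exact: diff_derivable.
Qed.

Definition C1_map (R : realType) (n : nat) (F : 'rV[R]_n -> 'rV[R]_n) : Prop :=
  (forall x, differentiable F x) /\ continuous (jacobian_matrix F).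

(* [eigenvalue] only detects eigenvalues in the field of coefficients, so a real
   matrix is first mapped to R[i] to speak about its complex eigenvalues. *)
Definition complex_eigenvalue (R : realType) (n : nat) (A : 'M[R]_n)
  (lambda : R[i]) : bool := eigenvalue (map_mx (real_complex R) A) lambda.

(* Main.v *)
(* The hypothesis on the symmetric part gives [c |v|^2 <= |<F'(z) v, v>|] for all
   [z] and [v], so by the mean value theorem applied to [<F (y + t v), v>],
   [F] is expanding: [c' |x - y| <= |F x - F y|].
   A differentiable expanding map of R^n is injective with invertible
   differentials.  It is surjective because [|F x - y|^2] is coercive, and at a
   minimiser its gradient [2 F'(x)^T (F x - y)] vanishes.  The inverse is
   Lipschitz, which turns the differential of [F] at [G y] into that of [G] at
   [y]; its continuity follows from A^-1 - B^-1 = - A^-1 (A - B) B^-1.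
   Norms are sup norms, which costs the factors [n] in the constants. *)
Require Import Defs.
From HB Require Import structures.
From mathcomp Require Import all_boot all_order all_algebra.
From mathcomp Require Import all_classical all_reals all_analysis.
From mathcomp Require Import complex.
From mathcomp Require Import ring lra.
Import Order.TTheory GRing.Theory Num.Theory.
Import numFieldNormedType.Exports.
Local Open Scope ring_scope.

Set Implicit Arguments.
Unset Strict Implicit.
Unset Printing Implicit Defensive.

(** * Sup norm estimates for matrices and continuity of matrix operations *)

Section MatrixNorm.
Context {R : realType}.

Lemma ler_coord_norm m n (A : 'M[R]_(m, n)) i j : `|A i j| <= `|A|.
Proof.
rewrite [leRHS]/Num.Def.normr/= mx_normrE.
exact: (le_bigmax _ (fun ij => `|A ij.1 ij.2|) (i, j)).
Qed.

Lemma mx_norm_le m n (A : 'M[R]_(m, n)) e :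
  0 <= e -> (forall i j, `|A i j| <= e) -> `|A| <= e.
Proof.
move=> e0 Ae; rewrite [leLHS]/Num.Def.normr/= mx_normrE.
by apply: bigmax_le => // -[i j] _; exact: Ae.
Qed.

Lemma mx_norm_mulmx m n p (A : 'M[R]_(m, n)) (B : 'M[R]_(n, p)) :
  `|A *m B| <= n%:R * `|A| * `|B|.
Proof.
apply: mx_norm_le => [|i j]; first by rewrite !mulr_ge0.
rewrite mxE (le_trans (ler_norm_sum _ _ _))//.
rewrite (le_trans (ler_sum _ (G := fun=> `|A| * `|B|) _))//.
  by move=> k _; rewrite normrM ler_pM ?ler_coord_norm.
by rewrite sumr_const card_ord -mulrA mulr_natl.
Qed.

Lemma mx_norm_row m n (A : 'M[R]_(m, n)) e :
  0 <= e -> (forall i, `|row i A| <= e) -> `|A| <= e.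
Proof.
move=> e0 Ae; apply: mx_norm_le => // i j; apply: le_trans (Ae i).
by rewrite (le_trans _ (ler_coord_norm (row i A) 0 j))// mxE.
Qed.

Lemma mx_norm_delta m n (i : 'I_m) (j : 'I_n) :
  `|delta_mx i j : 'M[R]_(m, n)| <= 1.
Proof.
apply: mx_norm_le => // k l; rewrite mxE.
by case: (_ && _); rewrite ?normr1 ?normr0.
Qed.

Lemma mulmxr_continuous m n p (A : 'M[R]_(n, p)) :
  continuous (fun B : 'M[R]_(m, n) => B *m A).
Proof.
apply: (@bounded_linear_continuous R _ _ (mulmxr A)).
apply/linear_boundedP; near=> r => B.
rewrite (le_trans (mx_norm_mulmx _ _))// mulrAC ler_wpM2r//.
Unshelve. all: by end_near. Qed.

Lemma trmx_continuous m n : continuous (@trmx R m n).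
Proof.
apply: (@bounded_linear_continuous R _ _ (@trmx R m n)).
apply/linear_boundedP; near=> r => A.
rewrite (@le_trans _ _ (1 * `|A|))// ?ler_wpM2r// mul1r.
by apply: mx_norm_le => // i j; rewrite mxE ler_coord_norm.
Unshelve. all: by end_near. Qed.

End MatrixNorm.

(** * The Euclidean inner product, compared with the sup norm *)

Section Dot.
Context {R : realType} {n : nat}.
Implicit Types u v w : 'rV[R]_n.

(** Encoded as the entry of a 1 by 1 matrix product, so that bilinearity and the adjoint rule
    [dot_mulmx] come from matrix algebra. *)
Definition dot u v : R := (u *m v^T) 0 0.

Lemma dotE u v : dot u v = \sum_i u 0 i * v 0 i.
Proof. by rewrite /dot mxE; apply: eq_bigr => i _; rewrite mxE. Qed.

Lemma dotC u v : dot u v = dot v u.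
Proof. by rewrite !dotE; apply: eq_bigr => i _; rewrite mulrC. Qed.

Lemma dotDl u v w : dot (u + v) w = dot u w + dot v w.
Proof. by rewrite /dot mulmxDl mxE. Qed.

Lemma dotZl a u v : dot (a *: u) v = a * dot u v.
Proof. by rewrite /dot -scalemxAl mxE. Qed.

Lemma dotBl u v w : dot (u - v) w = dot u w - dot v w.
Proof. by rewrite -scaleN1r dotDl dotZl mulN1r. Qed.

Lemma dotDr u v w : dot u (v + w) = dot u v + dot u w.
Proof. by rewrite !(dotC u) dotDl. Qed.

Lemma dotZr a u v : dot u (a *: v) = a * dot u v.
Proof. by rewrite !(dotC u) dotZl. Qed.

Lemma dot_mulmx u v (A : 'M[R]_n) : dot (u *m A) v = dot (v *m A^T) u.
Proof. by rewrite dotC /dot trmx_mul mulmxA. Qed.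

(** Each squared coordinate is one term of a sum of squares, so the sup norm is at most the
    Euclidean norm. *)
Lemma dotvv_ge u : `|u| ^+ 2 <= dot u u.
Proof.
have uu_ge0 : 0 <= dot u u by rewrite dotE sumr_ge0// => i _; exact: sqr_ge0.
rewrite -(sqr_sqrtr uu_ge0) ler_sqr ?nnegrE ?sqrtr_ge0//.
apply: mx_norm_le => [|i j]; first exact: sqrtr_ge0.
rewrite ord1 -sqrtr_sqr ler_sqrt// dotE (bigD1 j)//= expr2 lerDl.
by rewrite sumr_ge0// => k _; exact: sqr_ge0.
Qed.

Lemma dotvv_ge0 u : 0 <= dot u u.
Proof. exact: le_trans (dotvv_ge u). Qed.

Lemma dotvv_eq0 u : dot u u = 0 -> u = 0.
Proof.
move=> uu0; apply/eqP; rewrite -normr_eq0 -sqrf_eq0 eq_le sqr_ge0 andbT.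
by rewrite -[leRHS]uu0 dotvv_ge.
Qed.

Lemma dot_norm_le u v : `|dot u v| <= n%:R * `|u| * `|v|.
Proof.
rewrite /dot (le_trans (ler_coord_norm _ _ _))//.
rewrite (le_trans (mx_norm_mulmx _ _))// ler_wpM2l ?mulr_ge0//.
by apply: mx_norm_le => // i j; rewrite mxE ler_coord_norm.
Qed.

Lemma dot_continuous (T : topologicalType) (f g : T -> 'rV[R]_n) :
  continuous f -> continuous g -> continuous (fun x => dot (f x) (g x)).
Proof.
move=> cf cg; rewrite (_ : (fun _ => _) = fun x => \sum_i f x 0 i * g x 0 i); last first.
  by apply/funext => x; rewrite dotE.
apply: continuous_big => [|i _ x]; first exact: add_continuous.
  apply: cvgM.
    exact: continuous_comp (cf x) (@coord_continuous _ _ _ _ _ _).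
  exact: continuous_comp (cg x) (@coord_continuous _ _ _ _ _ _).
Qed.

Lemma is_derive_dot (f g : R -> 'rV[R]_n) (t : R) (df dg : 'rV[R]_n) :
  is_derive t 1 f df -> is_derive t 1 g dg ->
  is_derive t 1 (fun s => dot (f s) (g s)) (dot (f t) dg + dot df (g t)).
Proof.
have coord (h : R -> 'rV[R]_n) dh i : is_derive t (1 : R) h dh ->
    is_derive t 1 (fun s => h s 0 i : R) (dh 0 i).
  move=> [hd <-]; apply: DeriveDef; first by move/derivable_mxP : hd; apply.
  by rewrite derive_mx// mxE.
move=> fd gd; rewrite (_ : (fun _ => _) =
    \sum_i (fun s => f s 0 i) * (fun s => g s 0 i)); last first.
  by apply/funext => s; rewrite dotE fct_sumE.
have -> : dot (f t) dg + dot df (g t) =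
    \sum_i (f t 0 i *: dg 0 i + g t 0 i *: df 0 i).
  rewrite !dotE -big_split; apply: eq_bigr => i _.
  by rewrite [in RHS]/GRing.scale/= [g t 0 i * _]mulrC.
apply: is_derive_sum => i.
by apply: is_deriveM; exact: coord.
Qed.

End Dot.

(** * Spectral lower bound for symmetric quadratic forms *)

(** Perturbing [u] along [w = u *m M] gives a nonnegative quadratic in [t] without constant term, so
    its linear coefficient, twice [dot w w], must vanish. *)
Lemma psd_form_eq0 (R : realType) n (M : 'M[R]_n) (u : 'rV[R]_n) :
  M^T = M -> (forall v, 0 <= dot (v *m M) v) -> dot (u *m M) u = 0 ->
  u *m M = 0.
Proof.
move=> symM psd uM0; apply: dotvv_eq0; apply/eqP; apply: contraT => w_neq0.
set w := u *m M in w_neq0 *; set a := dot w w; set b := dot (w *m M) w.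
have a_gt0 : 0 < a by rewrite lt_neqAle eq_sym w_neq0 dotvv_ge0.
(* [b t^2 + 2 a t >= 0] for all [t] fails just below [t = 0]. *)
have quad t : 0 <= t * (2 * a + t * b).
  have := psd (u + t *: w); rewrite mulmxDl -scalemxAl dotDl !dotDr !dotZl !dotZr.
  rewrite uM0 (dot_mulmx w u) symM -/w -/a -/b => /le_trans; apply.
  by rewrite le_eqVlt; apply/orP; left; apply/eqP; ring.
have b_ge0 : 0 <= b by exact: psd.
have := quad (- (a / (b + 1))).
have b1_gt0 : 0 < b + 1 by rewrite ltr_wpDl.
have k_gt0 : 0 < a / (b + 1) by rewrite divr_gt0.
have kb : a / (b + 1) * b < a.
  by rewrite mulrAC ltr_pdivrMr// ltr_pM2l// ltrDl.
by rewrite mulNr oppr_ge0 pmulr_rle0// mulNr; lra.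
Qed.

(** The minimum [mu] of the form on the Euclidean unit sphere is an eigenvalue: [S - mu%:M] is
    positive semidefinite and its form vanishes at the minimiser, which [psd_form_eq0] turns into an
    eigenvector. *)
Lemma symmetric_form_ge (R : realType) n (S : 'M[R]_n) (e : R) :
  S^T = S -> (forall mu, eigenvalue S mu -> e <= mu) ->
  forall v, e * dot v v <= dot (v *m S) v.
Proof.
move=> symS Se v; have [->|v_neq0] := eqVneq v 0.
  by rewrite mul0mx /dot mul0mx mxE mulr0.
pose sphere := [set u : 'rV[R]_n | dot u u = 1]%classic.
have normalize u : u != 0 -> sphere ((Num.sqrt (dot u u))^-1 *: u).
  move=> u_neq0; rewrite /sphere/= dotZl dotZr mulrA -invfM -expr2.
  rewrite sqr_sqrtr ?dotvv_ge0// mulVf//.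
  by apply: contra u_neq0 => /eqP/dotvv_eq0 ->.
have closed_sphere : closed sphere.
  rewrite (_ : sphere = (fun u => dot u u) @^-1` [set 1])%classic//.
  apply: closed_comp => [u _|]; last exact: closed_eq.
  by apply: dot_continuous => ?; exact: cvg_id.
have bounded_sphere : bounded_set sphere.
  exists 1; split => // M M1 u uS; apply: le_trans (ltW M1).
  by rewrite -(@expr_le1 _ 2)//= -[leRHS]uS dotvv_ge.
have form_continuous : continuous (fun u : 'rV[R]_n => dot (u *m S) u).
  apply: dot_continuous => u; last exact: cvg_id.
  exact: mulmxr_continuous.
have [u uS umin] := EVT_min_rV (ex_intro _ _ (normalize v v_neq0))
  (bounded_closed_compact bounded_sphere closed_sphere)
  (continuous_subspaceT form_continuous).
have {}uS : dot u u = 1 by move: uS; rewrite inE.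
set mu := dot (u *m S) u in umin.
have formB w : dot (w *m (S - mu%:M)) w = dot (w *m S) w - mu * dot w w.
  by rewrite mulmxBr mul_mx_scalar dotBl dotZl.
(* Homogeneity of degree two carries minimality from the sphere to every nonzero [w]. *)
have psd w : 0 <= dot (w *m (S - mu%:M)) w.
  have [->|w_neq0] := eqVneq w 0; first by rewrite mul0mx /dot mul0mx mxE.
  rewrite formB; have := umin _ (mem_set (normalize w w_neq0)).
  rewrite -scalemxAl dotZl dotZr mulrA -invfM -expr2 sqr_sqrtr ?dotvv_ge0//.
  have ww_gt0 : 0 < dot w w.
    rewrite lt_neqAle dotvv_ge0 andbT eq_sym.
    by apply: contra w_neq0 => /eqP/dotvv_eq0 ->.
  by rewrite mulrC ler_pdivlMr// subr_ge0.
have eig : eigenvalue S mu.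
  apply/eigenvalueP; exists u.
    apply/eqP; rewrite -subr_eq0 -mul_mx_scalar -mulmxBr; apply/eqP.
    apply: psd_form_eq0 => //; first by rewrite linearB/= tr_scalar_mx symS.
    by rewrite formB uS mulr1 subrr.
  by apply: contra_eq_neq uS => ->; rewrite /dot mul0mx mxE eq_sym oner_eq0.
have := psd v; rewrite formB subr_ge0; apply: le_trans.
by rewrite ler_wpM2r ?dotvv_ge0 ?Se.
Qed.

(** * Differentials as first-order estimates, and a mean value theorem *)

Section DiffNear.
Context {R : realType} {V W : normedModType R}.
Implicit Types (f : V -> W) (x : V).

Lemma diff_near f x (e : R) : differentiable f x -> 0 < e ->
  \forall h \near nbhs (0 : V), `|f (x + h) - f x - 'd f x h| <= e * `|h|.
Proof.
move=> /diff_locally/eqaddoP/(_ e) + e0 => /(_ e0); apply: filterS => h.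
by rewrite !fctE/= opprD addrA [h + x]addrC.
Qed.

Lemma near_diff f (L : {linear V -> W}) x : continuous L ->
  (forall e : R, 0 < e ->
    \forall h \near nbhs (0 : V), `|f (x + h) - f x - L h| <= e * `|h|) ->
  differentiable f x /\ 'd f x = L :> (V -> W).
Proof.
move=> cL dL.
have fo : f \o shift x = cst (f x) + L +o_ 0 id.
  apply/eqaddoP => e e0; move: (dL e e0); apply: filterS => h.
  by rewrite !fctE/= opprD addrA [h + x]addrC.
have dE : 'd f x = L :> (V -> W) by exact: diff_unique.
by split=> //; apply/diff_locallyP; rewrite dE.
Qed.

End DiffNear.

Section Differential.
Context {R : realType} {n : nat}.
Implicit Types (F : 'rV[R]_n -> 'rV[R]_n) (x v : 'rV[R]_n).

(** The difference quotient at [t] along the line is the directional difference quotient of [F] at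
    [x + t *: v]. *)
Lemma is_derive_line F x v (t : R) : differentiable F (x + t *: v) ->
  is_derive t (1 : R) (fun s : R => F (x + s *: v))
    (v *m jacobian F (x + t *: v)).
Proof.
move=> dF; rewrite -(deriveEjacobian _ dF).
have quotE : (fun h : R => h^-1 *: (((fun s : R => F (x + s *: v)) \o shift t)
      (h *: (1 : R)) - F (x + t *: v))) =
    (fun h : R => h^-1 *: ((F \o shift (x + t *: v)) (h *: v) - F (x + t *: v))).
  by apply/funext => h /=; rewrite addrCA scalerDl [h *: 1]mulr1.
apply: DeriveDef; last by rewrite /derive quotE.
by have := @diff_derivable _ _ _ _ _ v dF; rewrite /derivable quotE.
Qed.

(** Used from left to right on [F], and from right to left to differentiate its inverse. *)
Lemma diff_jacobianP F x (A : 'M[R]_n) :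
  differentiable F x /\ jacobian F x = A <->
  forall e, 0 < e ->
    \forall h \near nbhs (0 : 'rV[R]_n),
      `|F (x + h) - F x - h *m A| <= e * `|h|.
Proof.
split=> [[dF <-] e e0|dA].
  have := diff_near dF e0; apply: filterS => h.
  by rewrite /jacobian mul_rV_lin1.
have [|dF dE] := @near_diff _ _ _ F (mulmxr A) x _ dA.
  exact: mulmxr_continuous.
split=> //.
by apply/row_matrixP => i; rewrite !rowE /jacobian mul_rV_lin1 dE.
Qed.

(** The mean value theorem holds for scalar functions, so it is applied on [0, 1] to the component
    of [F] along [v]. *)
Lemma dot_MVT F x v : (forall z, differentiable F z) ->
  exists z, dot (F (x + v) - F x) v = dot (v *m jacobian F z) v.
Proof.
move=> dF.
have dphi t : is_derive t (1 : R) (fun s : R => dot (F (x + s *: v)) v)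
    (dot (v *m jacobian F (x + t *: v)) v).
  apply: is_derive_eq; first by apply: is_derive_dot; exact: is_derive_line.
  by rewrite [dot _ 0]/dot trmx0 mulmx0 mxE add0r.
have [t _] := MVT ltr01 (fun t _ => dphi t)
  (derivable_within_continuous (fun t _ => @ex_derive _ _ _ _ _ _ _ (dphi t))).
rewrite scale1r scale0r addr0 -dotBl (subr0 (1 : R)) mulr1 => Et.
by exists (x + t *: v); exact: Et.
Qed.

End Differential.

Lemma invmxB (R : comUnitRingType) n (A B : 'M[R]_n) :
  A \in unitmx -> B \in unitmx ->
  invmx A - invmx B = - (invmx A *m (A - B) *m invmx B).
Proof.
by move=> uA uB; rewrite mulmxBr mulVmx// mulmxBl mul1mx mulmxK// opprB.
Qed.

(** * Expanding differentiable maps: injectivity, invertible differentials, surjectivity *)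

Section Expanding.
Context {R : realType} {n : nat} (F : 'rV[R]_n -> 'rV[R]_n) (c : R).
Hypotheses (c_gt0 : 0 < c) (dF : forall x, differentiable F x)
  (expF : forall x y, c * `|x - y| <= `|F x - F y|).

Let J x := jacobian F x.

Lemma expanding_inj : injective F.
Proof.
move=> x y Fxy; have := expF x y; rewrite Fxy subrr normr0 pmulr_rle0//.
by rewrite normr_le0 subr_eq0 => /eqP.
Qed.

(** Expansion between [x] and [x + t *: v], divided by [t], gives the bound up to an arbitrarily
    small remainder. *)
Lemma expanding_jacobian x (v : 'rV[R]_n) : c * `|v| <= `|v *m J x|.
Proof.
have [->|v_neq0] := eqVneq v 0; first by rewrite mul0mx !normr0 mulr0.
have v_gt0 : 0 < `|v| by rewrite normr_gt0.
apply/ler_addgt0Pl => e e_gt0.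
(* With relative error [e / |v|], the remainder at [t *: v] is at most [t * e]. *)
have ev_gt0 : 0 < e / `|v| by rewrite divr_gt0.
have /nbhs_norm0P[d /= d_gt0 Hd] :=
  (diff_jacobianP F x (J x)).1 (conj (dF x) erefl) _ ev_gt0.
(* This makes [t *: v] of norm [d / 2], inside the ball of validity. *)
pose t := d / 2 / `|v|.
have t_gt0 : 0 < t by rewrite !divr_gt0.
have normtv w : `|t *: w| = t * `|w| by rewrite normrZ gtr0_norm.
have tv_lt : `|t *: v| < d.
  by rewrite normtv divfK ?gt_eqF// ltr_pdivrMr// ltr_pMr// ltr1n.
have := Hd _ tv_lt; rewrite -scalemxAl => remtv.
have := expF (x + t *: v) x; rewrite [_ - x]addrAC subrr add0r.
rewrite -[F _ - F x](subrK (t *: (v *m J x))) => /le_trans/(_ (ler_normD _ _)).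
move=> /le_trans/(_ (lerD remtv (lexx _))); rewrite !normtv.
have -> : e / `|v| * (t * `|v|) = t * e by rewrite mulrCA divfK ?gt_eqF.
by rewrite mulrCA -mulrDr ler_pM2l// addrC.
Qed.

Lemma expanding_jacobian_unit x : J x \in unitmx.
Proof.
rewrite -row_free_unit; apply/inj_row_free => v vJ0; apply/eqP.
rewrite -normr_le0 -(pmulr_rle0 _ c_gt0).
by apply: le_trans (expanding_jacobian x v) _; rewrite vJ0 normr0.
Qed.

(** Row [i] of the inverse is sent by [J x] to a unit coordinate vector, so the lower bound on [J x]
    controls it, uniformly in [x]. *)
Lemma expanding_invmx_le x : `|invmx (J x)| <= c^-1.
Proof.
apply: mx_norm_row => [|i]; first by rewrite invr_ge0 ltW.
rewrite rowE -div1r ler_pdivlMr// mulrC (le_trans (expanding_jacobian x _))//.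
by rewrite mulmxKV ?expanding_jacobian_unit// mx_norm_delta.
Qed.

Lemma expanding_surj y : exists x, F x = y.
Proof.
have cF : continuous F by move=> x; exact: differentiable_continuous.
pose E x := dot (F x - y) (F x - y).
have cE : continuous E.
  have cFy : continuous (fun x => F x - y).
    by move=> x; apply: continuousB; [exact: cF|exact: cst_continuous].
  exact: dot_continuous.
pose K := [set x | E x <= E 0]%classic.
have closedK : closed K.
  rewrite (_ : K = E @^-1` [set r | r <= E 0])%classic//.
  by apply: closed_comp => [x _|]; [exact: cE|exact: closed_le].
(* For [s = |F x - y|] one has [s <= 1 + s ^ 2 <= 1 + E 0], and expansion from 0 then bounds
   [c * |x|]. *)
have boundedK : bounded_set K.
  exists ((1 + E 0 + `|y - F 0|) / c); split => [|M ltM x xK].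
    exact: num_real.
  apply: le_trans (ltW ltM); rewrite ler_pdivlMr// mulrC.
  have := expF x 0; rewrite subr0 => /le_trans; apply.
  rewrite -(subrKA y) (le_trans (ler_normD _ _))// lerD2r.
  have : `|F x - y| ^+ 2 <= E 0 by exact: le_trans (dotvv_ge _) xK.
  have := sqr_ge0 (`|F x - y| - 1); nra.
have [x xK xmin] := EVT_min_rV (ex_intro K 0 (lexx _))
  (bounded_closed_compact boundedK closedK) (continuous_subspaceT cE).
(* Outside [K] the value exceeds [E 0], hence the minimum over [K], so the minimum is global. *)
have {}xmin z : E x <= E z.
  have [zK|/ltW] := leP (E z) (E 0); first by apply: xmin; rewrite inE.
  by apply: le_trans; move: xK; rewrite inE.
exists x; apply/eqP; rewrite -subr_eq0; apply/eqP/dotvv_eq0.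
(* The direction [v] solves [v *m J x = w], so the derivative of [E] along it at [x] is twice
   [dot w w]. *)
set w := F x - y; pose v := w *m invmx (J x).
have dE (t : R) : is_derive t (1 : R) (fun s : R => E (x + s *: v))
    (2 * dot (v *m J (x + t *: v)) (F (x + t *: v) - y)).
  have dline : is_derive t (1 : R) (fun s : R => F (x + s *: v) - y)
      (v *m J (x + t *: v)).
    apply: is_derive_eq; last exact: subr0.
    by apply: is_deriveB; exact: is_derive_line.
  apply: is_derive_eq; first exact: is_derive_dot.
  by rewrite dotC mulr2n mulrDl !mul1r.
have dE0 : is_derive 0 (1 : R) (fun s : R => E (x + s *: v)) 0.
  apply: (@derive1_at_min _ _ (-1) 1) => [|t _||t _].
  - by rewrite (le_trans _ ler01)// lerN10.
  - exact: (@ex_derive _ _ _ _ _ _ _ (dE t)).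
  - by rewrite in_itv/= ltrN10 ltr01.
  - by rewrite scale0r addr0.
have := @derive_val _ _ _ _ _ _ _ (dE 0).
rewrite (@derive_val _ _ _ _ _ _ _ dE0) scale0r addr0.
rewrite mulmxKV ?expanding_jacobian_unit// => /eqP.
by rewrite eq_sym mulf_eq0 pnatr_eq0/= => /eqP.
Qed.

(** * Regularity of a right inverse of an expanding map *)

Section Inverse.
Context (G : 'rV[R]_n -> 'rV[R]_n) (GK : cancel G F).

Lemma expanding_inverse_lipschitz y z : `|G y - G z| <= c^-1 * `|y - z|.
Proof. by rewrite mulrC ler_pdivlMr// mulrC -[in leRHS](GK y) -[in leRHS](GK z). Qed.

Lemma expanding_inverse_continuous : continuous G.
Proof.
move=> y; apply/(@cvgrPdist_lt _ _ _ (nbhs y)) => e e_gt0.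
have ce_gt0 : 0 < c * e by rewrite mulr_gt0.
near=> z; rewrite (le_lt_trans (expanding_inverse_lipschitz y z))//.
rewrite mulrC ltr_pdivrMr// mulrC.
by near: z; exact: cvgr_dist_lt.
Unshelve. all: by end_near. Qed.

(* With [k = G (y + h) - G y] one has [k - h J^-1 = - (F (x + k) - F x - k J) J^-1],
   and [k] is [O(h)] because [G] is Lipschitz. *)
Lemma expanding_inverse_diff y :
  differentiable G y /\ jacobian G y = invmx (J (G y)).
Proof.
apply/diff_jacobianP => e e_gt0; set x := G y; set B := invmx (J x).
(* Chosen so that the remainder times [B] is at most [e * (c * |k|)], hence at most [e * |h|]; the
   added 1 keeps the denominator positive. *)
pose e' := e * c / (n%:R * `|B| + 1).
have nB_ge0 : 0 <= n%:R * `|B| by rewrite mulr_ge0.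
have nB_gt0 : 0 < n%:R * `|B| + 1 by rewrite ltr_wpDl.
have e'_gt0 : 0 < e' by rewrite divr_gt0// mulr_gt0.
have /nbhs_norm0P[d /= d_gt0 Hd] :=
  (diff_jacobianP F x (J x)).1 (conj (dF x) erefl) _ e'_gt0.
apply: (@nbhs_norm0P R 'rV[R]_n _).2; exists (c * d) => /=; first by rewrite mulr_gt0.
move=> h /= h_lt; set k := G (y + h) - x.
have k_le : c * `|k| <= `|h|.
  by rewrite (le_trans (expF _ _))// !GK addrAC subrr add0r.
have k_lt : `|k| < d by rewrite -(ltr_pM2l c_gt0) (le_lt_trans k_le).
have Fxk : F (x + k) = y + h by rewrite /k addrC subrK GK.
have := Hd k k_lt; rewrite Fxk [F x]GK [y + h]addrC addrK.
set r := _ - _ => r_le.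
have -> : k - h *m B = - (r *m B).
  by rewrite mulmxBl mulmxK ?expanding_jacobian_unit// opprB.
rewrite normrN (le_trans (mx_norm_mulmx _ _))//.
have : n%:R * `|r| * `|B| <= n%:R * `|B| * (e' * `|k|).
  by rewrite mulrAC ler_wpM2l.
move=> /le_trans; apply.
have -> : n%:R * `|B| * (e' * `|k|) =
    n%:R * `|B| / (n%:R * `|B| + 1) * (e * (c * `|k|)).
  by rewrite /e'; ring.
rewrite (@le_trans _ _ (e * (c * `|k|)))//; last by rewrite ler_pM2l.
rewrite ler_piMl ?mulr_ge0 ?(ltW e_gt0) ?(ltW c_gt0)//.
by rewrite ler_pdivrMr// mul1r lerDl.
Qed.

Lemma expanding_inverse_jacobian_continuous :
  continuous J -> continuous (jacobian G).
Proof.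
move=> cJ; have -> : jacobian G = fun y => invmx (J (G y)).
  by apply/funext => y; case: (expanding_inverse_diff y).
move=> y; apply/(@cvgrPdist_le _ _ _ (nbhs y)) => e e_gt0.
(* The two factors [n] come from two matrix products, the two factors [c^-1] from the uniform bound
   on the inverses at [G y] and [G z]. *)
pose e' := e / (n%:R * n%:R * c^-1 * c^-1 + 1).
have K_ge0 : 0 <= n%:R * n%:R * c^-1 * c^-1 :> R.
  by rewrite !mulr_ge0// invr_ge0 ltW.
have K_gt0 : 0 < n%:R * n%:R * c^-1 * c^-1 + 1 :> R by rewrite ltr_wpDl.
have e'_gt0 : 0 < e' by rewrite divr_gt0.
have cJG : {for y, continuous (J \o G)}.
  by apply: continuous_comp; [exact: expanding_inverse_continuous|exact: cJ].
have nearJ : \forall z \near nbhs y, `|J (G y) - J (G z)| <= e'.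
  exact: (@cvgrPdist_le _ _ _ (nbhs y) _ (J \o G) _).1 cJG _ e'_gt0.
near=> z; have Jz : `|J (G y) - J (G z)| <= e' by near: z.
rewrite invmxB ?expanding_jacobian_unit//.
rewrite normrN (le_trans (mx_norm_mulmx _ _))//.
rewrite (@le_trans _ _ (n%:R * (n%:R * c^-1 * e') * c^-1))//.
  rewrite ler_pM ?mulr_ge0 ?expanding_invmx_le// ler_wpM2l//.
  rewrite (le_trans (mx_norm_mulmx _ _))// ler_pM ?mulr_ge0//.
  by rewrite ler_wpM2l ?expanding_invmx_le.
rewrite (_ : _ * _ = n%:R * n%:R * c^-1 * c^-1 * e'); last by ring.
by rewrite /e' mulrCA ler_piMr ?(ltW e_gt0)// ler_pdivrMr// mul1r lerDl.
Unshelve. all: by end_near. Qed.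

End Inverse.
End Expanding.

(** * From the spectral hypothesis to expansion *)

(** By [dot_MVT], [c * |x - y| ^ 2] is at most the pairing of [F x - F y] with [x - y], which is at
    most [n * |F x - F y| * |x - y|]; one factor [|x - y|] cancels. *)
Lemma monotone_expanding (R : realType) n (F : 'rV[R]_n -> 'rV[R]_n) (c : R) :
  (0 < n)%N -> (forall x, differentiable F x) ->
  (forall x v, c * dot v v <= `|dot (v *m jacobian F x) v|) -> 0 < c ->
  forall x y, c / n%:R * `|x - y| <= `|F x - F y|.
Proof.
move=> n_gt0 dF monF c_gt0 x y.
have [->|xy_neq0] := eqVneq (x - y) 0; first by rewrite normr0 mulr0.
have [z Ez] := dot_MVT y (x - y) dF; rewrite [y + _]addrC subrK in Ez.
have xy_gt0 : 0 < `|x - y| by rewrite normr_gt0.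
rewrite mulrAC ler_pdivrMr ?ltr0n// [leRHS]mulrC -(ler_pM2r xy_gt0).
rewrite -mulrA -expr2 (le_trans _ (dot_norm_le _ _))// Ez.
by rewrite (le_trans _ (monF _ _))// ler_pM2l// dotvv_ge.
Qed.

Lemma dot_symmetrize (R : realType) n (A : 'M[R]_n) v :
  dot (v *m (A + A^T)) v = 2 * dot (v *m A) v.
Proof. by rewrite mulmxDr dotDl -[in X in _ + X]dot_mulmx mulr2n mulrDl mul1r. Qed.

(** The form of [A + A^T] is twice that of [A], hence [e / 2]. The negative case reduces to the
    positive one for [- A], whose symmetrised eigenvalues change sign. *)
Lemma symmetrized_form_ge (R : realType) n (A : 'M[R]_n) (e : R) :
  (forall mu, eigenvalue (A + A^T) mu -> e <= mu) \/
  (forall mu, eigenvalue (A + A^T) mu -> mu <= - e) ->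
  forall v, e / 2 * dot v v <= `|dot (v *m A) v|.
Proof.
have symA (B : 'M[R]_n) : (B + B^T)^T = B + B^T.
  by rewrite linearD/= trmxK addrC.
have pos (B : 'M[R]_n) : (forall mu, eigenvalue (B + B^T) mu -> e <= mu) ->
    forall v, e / 2 * dot v v <= dot (v *m B) v.
  move=> eB v; have := symmetric_form_ge (symA B) eB v.
  by rewrite dot_symmetrize mulrAC ler_pdivrMr// [_ * 2]mulrC.
case=> [eA|eA] v; first exact: le_trans (pos A eA v) (ler_norm _).
rewrite -normrN (le_trans _ (ler_norm _))//.
have -> : - dot (v *m A) v = dot (v *m - A) v.
  by rewrite /dot mulmxN mulNmx [RHS]mxE.
apply: pos => mu /eigenvalueP[w wE w_neq0]; rewrite -lerN2.
apply: eA; apply/eigenvalueP; exists w => //.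
have -> : A + A^T = - (- A + (- A)^T) by rewrite linearN/= -opprD opprK.
by rewrite mulmxN wE scaleNr.
Qed.

Unset Implicit Arguments.
Set Strict Implicit.
Set Printing Implicit Defensive.

Theorem theorem1p7 (R : realType) (n : nat) (hn : (1 <= n)%N)
  (F : 'rV[R]_n -> 'rV[R]_n) (hF : C1_map F)
  (hyp : exists eps : R, 0 < eps /\
    (forall (x : 'rV[R]_n) (lambda : R[i]),
      complex_eigenvalue (jacobian_matrix F x) lambda ->
      (eps%:C)%C <= `|lambda|) /\
    ((forall (x : 'rV[R]_n) (mu : R),
       eigenvalue (jacobian_matrix F x + (jacobian_matrix F x)^T) mu ->
       eps <= mu) \/
     (forall (x : 'rV[R]_n) (mu : R),
       eigenvalue (jacobian_matrix F x + (jacobian_matrix F x)^T) mu ->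
       mu <= - eps))) :
  injective F /\
  exists G : 'rV[R]_n -> 'rV[R]_n,
    C1_map G /\ (forall x : 'rV[R]_n, F (G x) = x) /\
    (forall x : 'rV[R]_n, G (F x) = x).
Proof.
case: hF => dF cJ; case: hyp => eps [eps_gt0 [_ spec]].
have cj : continuous (jacobian F).
  rewrite (_ : jacobian F = fun x => (jacobian_matrix F x)^T); last first.
    by apply/funext => x; rewrite trmxK.
  by move=> x; apply: continuous_comp (cJ x) (@trmx_continuous _ _ _ _).
(* The 2 comes from symmetrisation, the [n] from bounding the inner product by sup norms. *)
have c_gt0 : 0 < eps / 2 / n%:R by rewrite !divr_gt0// ltr0n.
have expF : forall x y, eps / 2 / n%:R * `|x - y| <= `|F x - F y|.
  apply: monotone_expanding => //; last by rewrite divr_gt0.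
  move=> x; apply: symmetrized_form_ge.
  (* Symmetrising erases the transpose between the two Jacobian conventions. *)
  have E : jacobian F x + (jacobian F x)^T =
      jacobian_matrix F x + (jacobian_matrix F x)^T by rewrite trmxK addrC.
  by rewrite E; case: spec => H; [left|right]; exact: H.
have injF := expanding_inj c_gt0 expF.
have [G GK] := choice (expanding_surj c_gt0 dF expF).
(* The left inverse law follows by injectivity from [F (G (F x)) = F x]. *)
split=> //; exists G; split; last by split=> // x; apply: injF; rewrite GK.
split=> [y|]; first by case: (expanding_inverse_diff c_gt0 dF expF GK y).
have cG := expanding_inverse_jacobian_continuous c_gt0 dF expF GK cj.
by move=> y; apply: continuous_comp (cG y) (@trmx_continuous _ _ _ _).
Qed.
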